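(* Let $x^*\in\mathcal{X}$ and let $t^*=(t_1^*,\dots,t_{\bar p}^* )^\top$ be given by $t_j^*=\frac{1}{c_j^\top x^*+d_j}$ for $j=1,\dots,\bar p$. Then $x^*$ is a global optimal solution of problem (P) if and only if $(x^*,t^* )$ is a global optimal solution of problem (P$_1$).
   Context: Setting. $p\ge 2$, $A\in\mathbb{R}^{m\times n}$, $b\in\mathbb{R}^m$, $\mathcal{X}=\{x\in\mathbb{R}^n : Ax\le b\}$ is nonempty, bounded and $n$-dimensional; $c_j\in\mathbb{R}^n$, $d_j\in\mathbb{R}$, $\alpha_j\in\mathbb{R}\setminus\{0\}$ and $\min_{x\in\mathcal{X}}(c_j^\top x+d_j)>0$ for $j=1,\dots,p$. The indices are ordered so that $\alpha_j>0$ for $j\in J^+=\{1,\dots,\bar p\}$ and $\alpha_j<0$ for $j\in J^-=\{\bar p+1,\dots,p\}$, where $1\le\bar p\le p$. For $j\in J^+$ let $$\underline t_j=\frac{1}{\max_{x\in\mathcal{X}}(c_j^\top x+d_j)}>0,\qquad \overline t_j=\frac{1}{\min_{x\in\mathcal{X}}(c_j^\top x+d_j)}.$$ Let $\mathcal{S}^0\subset\mathbb{R}^{\bar p}$ be the simplex (convex hull) with vertices $v^{0,1}=(\underline t_1,\dots,\underline t_{\bar p})^\top$ and $v^{0,j+1}=v^{0,1}+\bar p(\overline t_j-\underline t_j)e_j$, $j=1,\dots,\bar p$, where $e_j$ is the $j$-th standard basis vector. Problem (P): minimize $\nu(x)=\sum_{j=1}^p\alpha_j\ln(c_j^\top x+d_j)$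 subject to $x\in\mathcal{X}$. Problem (P$_1$): minimize $$\phi(x,t)=\sum_{j\in J^-}\alpha_j\ln(c_j^\top x+d_j)+\sum_{j\in J^+}\alpha_j\bigl(t_j(c_j^\top x+d_j)-\ln t_j-1\bigr)$$ subject to $x\in\mathcal{X}$, $t\in\mathcal{S}^0$. *)

(* Defs.v *)
From HB Require Import structures.
From mathcomp Require Import all_boot all_order all_algebra.
From mathcomp Require Import all_classical all_reals all_analysis.

Set Implicit Arguments.
Unset Strict Implicit.
Unset Printing Implicit Defensive.

Import Order.TTheory GRing.Theory Num.Theory.
Import numFieldNormedType.Exports.

Local Open Scope classical_set_scope.
Local Open Scope ring_scope.

(* When [E] has a maximum this is that maximum (it is then unique); the value
   is [0] otherwise. Same convention for [set_min]. *)
Definition set_max (R : realType) (E : set R) : R :=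
  xget 0 [set y | E y /\ ubound E y].

Definition set_min (R : realType) (E : set R) : R :=
  xget 0 [set y | E y /\ lbound E y].

Definition global_minimizer (R : realType) (T : Type) (F : set T)
  (f : T -> R) (x : T) : Prop := F x /\ forall y, F y -> f x <= f y.

Definition affinely_independent (R : realType) (n k : nat)
    (v : 'I_k -> 'cV[R]_n) : Prop :=
  forall a : 'I_k -> R, \sum_i a i = 0 -> \sum_i a i *: v i = 0 ->
    forall i, a i = 0.

(* The largest size of an affinely independent family in [E] is [k + 1]. *)
Definition has_affine_dim (R : realType) (n : nat) (E : set 'cV[R]_n)
    (k : nat) : Prop :=
  (exists2 v : 'I_k.+1 -> 'cV[R]_n,
     affinely_independent v & forall i, E (v i)) /\
  ~ (exists2 v : 'I_k.+2 -> 'cV[R]_n,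
     affinely_independent v & forall i, E (v i)).

Definition convex_hull (R : realType) (n k : nat) (v : 'I_k -> 'cV[R]_n) :
    set 'cV[R]_n :=
  [set x | exists w : 'I_k -> R,
     [/\ forall i, 0 <= w i, \sum_i w i = 1 & x = \sum_i w i *: v i]].

Definition polyhedron (R : realType) (m n : nat) (A : 'M[R]_(m, n))
    (b : 'cV[R]_m) : set 'cV[R]_n :=
  [set x | forall i, (A *m x) i 0 <= b i 0].

Definition affine_form (R : realType) (n : nat) (c : 'cV[R]_n) (d : R)
    (x : 'cV[R]_n) : R := (c^T *m x) 0 0 + d.

(* [q] is \bar p. The indices [1, ..., p] are the ordinals in ['I_p]; [J^+] is ['I_q], embedded
   in ['I_p] by [widen_ord]; [J^-] consists of the [j] with [q <= j < p]. *)

Section Problems.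
Variables (R : realType) (n p q : nat) (le_qp : (q <= p)%N).
Variables (X : set 'cV[R]_n) (c : 'I_p -> 'cV[R]_n) (d alpha : 'I_p -> R).

Definition t_lower (j : 'I_q) : R :=
  let i := widen_ord le_qp j in 1 / set_max (affine_form (c i) (d i) @` X).

Definition t_upper (j : 'I_q) : R :=
  let i := widen_ord le_qp j in 1 / set_min (affine_form (c i) (d i) @` X).

Definition simplex_vertex (k : 'I_q.+1) : 'cV[R]_q :=
  let v1 : 'cV[R]_q := \col_j t_lower j in
  if unlift ord0 k is Some j
  then v1 + (q%:R * (t_upper j - t_lower j)) *: delta_mx j 0
  else v1.

Definition initial_simplex : set 'cV[R]_q := convex_hull simplex_vertex.

Definition nu (x : 'cV[R]_n) : R :=
  \sum_(j < p) alpha j * ln (affine_form (c j) (d j) x).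

Definition phi (xt : 'cV[R]_n * 'cV[R]_q) : R :=
  \sum_(j < p | (q <= j)%N) alpha j * ln (affine_form (c j) (d j) xt.1) +
  \sum_(j < q)
    (let i := widen_ord le_qp j in
     alpha i * (xt.2 j 0 * affine_form (c i) (d i) xt.1 - ln (xt.2 j 0) - 1)).

End Problems.

(* Main.v *)
(* The linearization t y - ln t - 1 of ln y lies above ln y for every t > 0 and
   agrees with it at t = 1/y. Hence nu x <= phi (x, t) on the feasible set of
   (P_1), with equality at t_j = 1/(c_j^T x + d_j), and the two minimization
   problems correspond as soon as that point lies in the simplex. It does,
   because the simplex contains the box of the [t_lower, t_upper]; conversely
   every coordinate of a point of the simplex is at least t_lower, which is
   positive because a nonempty compact polyhedron attains its maxima. *)
Require Import Defs.
From mathcomp Require Import all_boot all_order all_algebra.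
From mathcomp Require Import all_classical all_reals all_analysis.
From mathcomp Require Import lra.

Set Implicit Arguments.
Unset Strict Implicit.
Unset Printing Implicit Defensive.

Import Order.TTheory GRing.Theory Num.Theory.
Import numFieldNormedType.Exports.

Local Open Scope classical_set_scope.
Local Open Scope ring_scope.

(** This is [ln (1 + u) <= u] at [u = t * y - 1], with [ln (t * y)] split into a sum. *)
Lemma ln_le_linearization (R : realType) (t y : R) :
  0 < t -> 0 < y -> ln y <= t * y - ln t - 1.
Proof.
move=> t0 y0; have ty0 : 0 < t * y by rewrite mulr_gt0.
have : ln (1 + (t * y - 1)) <= t * y - 1 by apply: le_ln1Dx; lra.
by rewrite addrC subrK lnM ?posrE//; lra.
Qed.

Lemma linearization_at_inv (R : realType) (y : R) :
  0 < y -> 1 / y * y - ln (1 / y) - 1 = ln y.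
Proof.
by move=> y0; rewrite div1r mulVf ?gt_eqF// lnV ?posrE//; lra.
Qed.

(* Positivity rules out the junk value 0 of [set_min]. *)
Lemma set_minP (R : realType) (E : set R) :
  0 < set_min E -> E (set_min E) /\ lbound E (set_min E).
Proof.
by rewrite /set_min; case: xgetP => [y -> //|_]; rewrite ltxx.
Qed.

Lemma set_maxP (R : realType) (E : set R) y :
  E y -> ubound E y -> E (set_max E) /\ ubound E (set_max E).
Proof.
move=> Ey uy; rewrite /set_max; case: xgetP => [z -> //|/(_ y)].
by case; split.
Qed.

Lemma continuous_mulmx_tr (R : realType) (k n : nat) (B : 'M[R]_(k, n)) i :
  continuous (fun u : 'rV[R]_n => (B *m u^T) i 0).
Proof.
rewrite (_ : (fun _ => _) = (fun u : 'rV[R]_n => \sum_j B i j * u 0 j)).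
  apply: (continuous_big add_continuous) => j _ u.
  exact: (cvgM (cvg_cst (B i j)) (@coord_continuous _ _ _ 0 j u)).
by apply/funext => u; rewrite mxE; apply: eq_bigr => j _; rewrite mxE.
Qed.

(** The norm is the largest absolute value of an entry. This carries boundedness over to row
    vectors. *)
Lemma mx_norm_tr (R : realType) (k n : nat) (B : 'M[R]_(k, n)) :
  `|B^T| = `|B|.
Proof.
have le_tr a b (C : 'M[R]_(a, b)) : `|C^T| <= `|C|.
  rewrite [leLHS]/Num.norm /= mx_normrE; apply/bigmax_leP; split => // -[i j] _.
  rewrite mxE /= [leRHS]/Num.norm /= mx_normrE.
  by apply/bigmax_geP; right; exists (j, i).
by apply/eqP; rewrite eq_le le_tr -{1}[B]trmxK le_tr.
Qed.

(* Transposes turn the column vectors into row vectors, on which the library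
   states the Heine-Borel theorem. *)
Lemma compact_polyhedron_tr (R : realType) (m n : nat) (A : 'M[R]_(m, n))
    (b : 'cV[R]_m) :
  bounded_set (polyhedron A b) ->
  compact [set u : 'rV[R]_n | polyhedron A b u^T].
Proof.
move=> [M [Mr bM]]; apply: bounded_closed_compact.
  by exists M; split=> // N MN u /(bM _ MN) /=; rewrite mx_norm_tr.
(* Closedness: the set is an intersection of closed half-spaces, one per row of [A]. *)
rewrite (_ : mkset _ = \bigcap_(i in setT)
    ((fun u : 'rV[R]_n => (A *m u^T) i 0) @^-1` [set y | y <= b i 0])).
  apply: closed_bigI => i _; apply: preimage_closed; last exact: closed_le.
  by move=> u _; exact: continuous_mulmx_tr.
by apply/seteqP; split=> u; [move=> uX i _; exact: uX|move=> uX i; exact: uX].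
Qed.

(** By the extreme value theorem on the transposed polyhedron, [set_max] is a true maximum here and
    not its default value 0. *)
Lemma affine_form_set_maxP (R : realType) (m n : nat) (A : 'M[R]_(m, n))
    (b : 'cV[R]_m) (c : 'cV[R]_n) (d : R) (X := polyhedron A b) :
  X !=set0 -> bounded_set X ->
  (affine_form c d @` X) (set_max (affine_form c d @` X)) /\
  ubound (affine_form c d @` X) (set_max (affine_form c d @` X)).
Proof.
move=> [x0 Xx0] bX.
pose Y := [set u : 'rV[R]_n | X u^T].
have Y0 : Y !=set0 by exists x0^T; rewrite /Y /= trmxK.
have cf : {within Y, continuous (fun u : 'rV[R]_n => affine_form c d u^T)}.
  apply: continuous_subspaceT => u.
  exact: (cvgD (@continuous_mulmx_tr R 1 n c^T 0 u) (cvg_cst d)).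
have [u /set_mem Yu umax] := EVT_max_rV Y0 (compact_polyhedron_tr bX) cf.
apply: (@set_maxP _ _ (affine_form c d u^T)); first by exists u^T.
move=> _ [x Xx <-]; have := umax x^T; rewrite trmxK; apply.
by apply/mem_set; rewrite /Y /= trmxK.
Qed.

Section Simplex.
Variables (R : realType) (n p q : nat) (le_qp : (q <= p)%N).
Variables (X : set 'cV[R]_n) (c : 'I_p -> 'cV[R]_n) (d : 'I_p -> R).

Let lo := t_lower le_qp X c d.
Let up := t_upper le_qp X c d.

(** All vertices have coordinate [lo j] at [j], except vertex [lift ord0 j], whose edge from the
    base vertex points along axis [j]. *)
Lemma simplex_vertex_combE (w : 'I_q.+1 -> R) (j : 'I_q) :
  \sum_k w k = 1 ->
  (\sum_k w k *: simplex_vertex le_qp X c d k) j 0 =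
  lo j + w (lift ord0 j) * (q%:R * (up j - lo j)).
Proof.
move=> w1; rewrite summxE.
rewrite (eq_bigr (fun k => w k * lo j +
    (if k == lift ord0 j then w k * (q%:R * (up j - lo j)) else 0))).
  by rewrite big_split /= -mulr_suml w1 mul1r -big_mkcond big_pred1_eq.
move=> k _; rewrite mxE /simplex_vertex.
case: unliftP => [i ->|->]; last by rewrite !mxE (negbTE (neq_lift _ _)) addr0.
rewrite !mxE (inj_eq lift_inj) eqxx andbT (eq_sym j).
by case: eqP => [->|_]; rewrite ?mulr1 ?mulr0 mulrDr// mulr0.
Qed.

Lemma initial_simplex_ge_lower (t : 'cV[R]_q) (j : 'I_q) :
  lo j <= up j -> initial_simplex le_qp X c d t -> lo j <= t j 0.
Proof.
move=> lu [w [w0 w1 ->]]; rewrite simplex_vertex_combE// lerDl.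
by rewrite !mulr_ge0 ?subr_ge0.
Qed.

(** The edges are [q] times as long as the sides of the box, so each coordinate uses weight at most
    [1/q]. The [q] weights then sum to at most 1, and the base vertex takes the remainder. *)
Lemma box_sub_initial_simplex (t : 'cV[R]_q) :
  (0 < q)%N -> (forall j, lo j <= t j 0 <= up j) ->
  initial_simplex le_qp X c d t.
Proof.
move=> q0 tb.
have q0R : (0 : R) < q%:R by rewrite ltr0n.
(* The weight of vertex j is 0, by division by 0, when [lo j = up j]. *)
pose r j := (t j 0 - lo j) / (q%:R * (up j - lo j)).
have r_ge0 j : 0 <= r j.
  have /andP[l u] := tb j.
  by rewrite divr_ge0 ?mulr_ge0 ?subr_ge0// (le_trans l u).
have r_le j : r j <= q%:R^-1.
  have /andP[l u] := tb j; rewrite /r invfM mulrCA ler_piMr ?invr_ge0 ?ler0n//.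
  have [e|ne] := eqVneq (up j - lo j) 0; first by rewrite e invr0 mulr0 ler01.
  have du : 0 < up j - lo j by rewrite lt0r ne subr_ge0 (le_trans l u).
  by rewrite ler_pdivrMr// mul1r lerB.
pose w k := if unlift ord0 k is Some j then r j else 1 - \sum_j r j.
have w_lift j : w (lift ord0 j) = r j by rewrite /w liftK.
have w_sum : \sum_k w k = 1.
  rewrite big_ord_recl (eq_bigr r) => [|j _]; last exact: w_lift.
  by rewrite /w unlift_none subrK.
exists w; split=> // [k|].
  rewrite /w; case: unliftP => [j _|_]; first exact: r_ge0.
  rewrite subr_ge0 (le_trans (ler_sum _ (fun j _ => r_le j)))//.
  by rewrite sumr_const card_ord -[_ *+ _]mulr_natr mulVf// gt_eqF.
apply/colP => j; rewrite simplex_vertex_combE// w_lift /r.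
have /andP[l u] := tb j.
(* On a degenerate side the box forces [t j 0 = lo j], which agrees with weight 0. *)
have [e|ne] := eqVneq (up j - lo j) 0.
  have -> : t j 0 = lo j by apply/eqP; rewrite eq_le l andbT; lra.
  by rewrite subrr !mul0r addr0.
by rewrite divfK ?mulf_neq0 ?(gt_eqF q0R)// addrC subrK.
Qed.

End Simplex.

(** Puts [nu] in the shape of [phi]: the sums over [q <= j] coincide, and only terms with positive
    [alpha] remain to be compared. *)
Lemma nu_splitE (R : realType) (n p q : nat) (le_qp : (q <= p)%N)
    (c : 'I_p -> 'cV[R]_n) (d alpha : 'I_p -> R) (x : 'cV[R]_n) :
  nu c d alpha x =
  \sum_(j < p | (q <= j)%N) alpha j * ln (affine_form (c j) (d j) x) +
  \sum_(j < q) (let i := widen_ord le_qp j in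
     alpha i * ln (affine_form (c i) (d i) x)).
Proof.
rewrite /nu (bigID (fun j : 'I_p => (q <= j)%N)) /=; congr +%R.
rewrite -(big_ord_narrow le_qp
  (F := fun i => alpha i * ln (affine_form (c i) (d i) x))).
by apply: eq_bigl => j; rewrite ltnNge.
Qed.

Theorem theorem2p1 (R : realType) (m n p q : nat)
  (A : 'M[R]_(m, n)) (b : 'cV[R]_m)
  (c : 'I_p -> 'cV[R]_n) (d alpha : 'I_p -> R)
  (p_ge2 : (2 <= p)%N) (q_ge1 : (1 <= q)%N) (le_qp : (q <= p)%N)
  (X_nonempty : polyhedron A b !=set0)
  (X_bounded : bounded_set (polyhedron A b))
  (X_dim : has_affine_dim (polyhedron A b) n)
  (alpha_neq0 : forall j : 'I_p, alpha j != 0)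
  (alpha_pos : forall j : 'I_p, (j < q)%N -> 0 < alpha j)
  (alpha_neg : forall j : 'I_p, (q <= j)%N -> alpha j < 0)
  (min_gt0 : forall j : 'I_p,
     0 < set_min (affine_form (c j) (d j) @` polyhedron A b))
  (xs : 'cV[R]_n) (xsX : polyhedron A b xs) (ts : 'cV[R]_q)
  (tsE : forall j : 'I_q,
     ts j 0 = 1 / affine_form (c (widen_ord le_qp j)) (d (widen_ord le_qp j)) xs) :
  global_minimizer (polyhedron A b) (nu c d alpha) xs <->
  global_minimizer
    (polyhedron A b `*` initial_simplex le_qp (polyhedron A b) c d)
    (phi le_qp c d alpha) (xs, ts).
Proof.
set X := polyhedron A b.
have f_min j : lbound (affine_form (c j) (d j) @` X)
    (set_min (affine_form (c j) (d j) @` X)) by case: (set_minP (min_gt0 j)).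
have f_gt0 j x : X x -> 0 < affine_form (c j) (d j) x.
  by move=> Xx; apply: lt_le_trans (min_gt0 j) _; apply: f_min; exists x.
have f_box (j : 'I_q) x (i := widen_ord le_qp j) : X x ->
    0 < t_lower le_qp X c d j <= 1 / affine_form (c i) (d i) x /\
    1 / affine_form (c i) (d i) x <= t_upper le_qp X c d j.
  move=> Xx; have fx0 := f_gt0 i _ Xx.
  have [_ /(_ (affine_form (c i) (d i) x)) max_ge] :=
    affine_form_set_maxP (c i) (d i) X_nonempty X_bounded.
  have {}max_ge := max_ge (ex_intro2 _ _ x Xx erefl).
  have max0 := lt_le_trans fx0 max_ge.
  rewrite /t_lower /t_upper !div1r invr_gt0 max0 /= !lef_pV2 ?posrE//.
  by split=> //; apply: f_min; exists x.
have inv_simplex x (t : 'cV[R]_q) : X x ->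
    (forall j (i := widen_ord le_qp j),
       t j 0 = 1 / affine_form (c i) (d i) x) ->
    initial_simplex le_qp X c d t.
  move=> Xx tE; apply: box_sub_initial_simplex => // j.
  by have [/andP[_ l] u] := f_box j x Xx; rewrite tE l u.
have phi_ge x t : X x -> initial_simplex le_qp X c d t ->
    nu c d alpha x <= phi le_qp c d alpha (x, t).
  move=> Xx St; rewrite (nu_splitE le_qp) lerD2l ler_sum// => j _ /=.
  rewrite ler_pM2l; last by apply: alpha_pos; exact: (ltn_ord j).
  apply: ln_le_linearization; last exact: f_gt0.
  (* The reciprocal at [x] lies between the two bounds, so [t_lower <= t_upper]; hence [t j 0] is at
     least the positive [t_lower]. *)
  have [/andP[l0 l] u] := f_box j x Xx.
  by apply: lt_le_trans l0 (initial_simplex_ge_lower (le_trans l u) St).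
have phi_inv x (t : 'cV[R]_q) : X x ->
    (forall j (i := widen_ord le_qp j),
       t j 0 = 1 / affine_form (c i) (d i) x) ->
    phi le_qp c d alpha (x, t) = nu c d alpha x.
  move=> Xx tE; rewrite (nu_splitE le_qp); congr +%R; apply: eq_bigr => j _ /=.
  by rewrite tE linearization_at_inv ?f_gt0.
split=> [[_ xs_min]|[_ xs_min]]; split=> //.
- by split=> //; exact: inv_simplex xsX tsE.
- move=> [x t] [/= Xx St]; rewrite phi_inv//.
  exact: le_trans (xs_min _ Xx) (phi_ge _ _ Xx St).
- move=> x Xx; rewrite -(phi_inv _ _ xsX tsE).
  (* Pairing [x] with its own reciprocals gives a feasible point where [phi] equals [nu x]. *)
  pose t := \col_(j < q)
    (1 / affine_form (c (widen_ord le_qp j)) (d (widen_ord le_qp j)) x).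
  have tE j : t j 0 =
    1 / affine_form (c (widen_ord le_qp j)) (d (widen_ord le_qp j)) x.
    by rewrite mxE.
  rewrite -(phi_inv _ _ Xx tE); apply: xs_min.
  by split=> //; exact: inv_simplex Xx tE.
Qed.
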